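(* Let $X$ be a set and $\lambda,q\in\mathbf{k}$, and let $j_X:X\to\mathrm{DT}(\Delta X)$ send $x$ to the tree with a single internal vertex (two leaves) decorated by $x^{(0)}$. Then $(\mathrm{DT}(\Delta X),\prec,\succ,\bullet,d_X)$ together with $j_X$ is the free differential $q$-tridendriform algebra of weight $\lambda$ on $X$: for every differential $q$-tridendriform algebra $(T,\prec_T,\succ_T,\bullet_T,d_T)$ of weight $\lambda$ and every map of sets $f:X\to T$, there is a unique linear map $\bar f:\mathrm{DT}(\Delta X)\to T$ preserving $\prec,\succ,\bullet$, satisfying $d_T\bar f=\bar f d_X$ and $\bar f j_X=f$.
   Context: $\mathbf{k}$ is a commutative unital ring. For a set $Y$, a valently decorated Schröder tree over $Y$ is a planar rooted tree in which every internal vertex has $k\ge2$ (ordered) children and is decorated by an element of $Y^{k-1}$; the tree with one leaf and no internal vertex is denoted $|$. Every tree $\tau\ne|$ is uniquely a grafting $\tau=\bigvee^{m+1}_{y_1,\dots,y_m}(\tau^{(0)},\dots,\tau^{(m)})$ ($m\ge1$) of trees $\tau^{(0)},\dots,\tau^{(m)}$ onto a new root decorated by $(y_1,\dots,y_m)$. Let $\mathrm{DT}(Y)$ be the free $\mathbf{k}$-module on all such trees other than $|$. Define bilinear $\prec,\succ,\bullet$ on $\mathrm{DT}(Y)$ recursively on total depth: for $\tau\ne|$, $|\succ\tau:=\tau\prec|:=\tau$, $|\prec\tau:=\tau\succ|:=0$, $|\bullet\tau:=\tau\bullet|:=0$, with the convention $|\prec|+|\succ|+q\,|\bullet|:=|$;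 and for $\tau=\bigvee^{m+1}_{x_1,\dots,x_m}(\tau^{(0)},\dots,\tau^{(m)})$, $\sigma=\bigvee^{n+1}_{y_1,\dots,y_n}(\sigma^{(0)},\dots,\sigma^{(n)})$, writing $u\star_q v:=u\succ v+u\prec v+q\,u\bullet v$: $\tau\prec\sigma:=\bigvee^{m+1}_{x_1,\dots,x_m}(\tau^{(0)},\dots,\tau^{(m-1)},\tau^{(m)}\star_q\sigma)$, $\tau\succ\sigma:=\bigvee^{n+1}_{y_1,\dots,y_n}(\tau\star_q\sigma^{(0)},\sigma^{(1)},\dots,\sigma^{(n)})$, $\tau\bullet\sigma:=\bigvee^{m+n+1}_{x_1,\dots,x_m,y_1,\dots,y_n}(\tau^{(0)},\dots,\tau^{(m-1)},\tau^{(m)}\star_q\sigma^{(0)},\sigma^{(1)},\dots,\sigma^{(n)})$ (grafting extended multilinearly). Let $\Delta X:=X\times\mathbb N=\{x^{(n)}\mid x\in X,n\ge0\}$ and take $Y=\Delta X$. Define $d_X:\mathrm{DT}(\Delta X)\to\mathrm{DT}(\Delta X)$ linearly by: if $\tau$ has decoration entries $x_1^{(r_1)},\dots,x_N^{(r_N)}$ (all entries of all vertex decorations, listed in some order), then $d_X(\tau)=\sum_{\emptyset\ne S\subseteq\{1,\dots,N\}}\lambda^{|S|-1}\tau_S$, where $\tau_S$ is the tree of the same shape with each entry $x_i^{(r_i)}$, $i\in S$, replaced by $x_i^{(r_i+1)}$. For $q\in\mathbf{k}$, a $q$-tridendriform algebra is a $\mathbf{k}$-module $T$ with bilinear operations $\prec,\succ,\bullet$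 such that, writing $\star_q:=\prec+\succ+q\bullet$, for all $a,b,c\in T$: $(a\prec b)\prec c=a\prec(b\star_q c)$, $(a\succ b)\prec c=a\succ(b\prec c)$, $(a\star_q b)\succ c=a\succ(b\succ c)$, $(a\succ b)\bullet c=a\succ(b\bullet c)$, $(a\prec b)\bullet c=a\bullet(b\succ c)$, $(a\bullet b)\prec c=a\bullet(b\prec c)$, $(a\bullet b)\bullet c=a\bullet(b\bullet c)$. A derivation of weight $\lambda$ on it is a linear map $d$ with $d(a\ast b)=d(a)\ast b+a\ast d(b)+\lambda d(a)\ast d(b)$ for each $\ast\in\{\prec,\succ,\bullet\}$ and all $a,b$; then $(T,\prec,\succ,\bullet,d)$ is a differential $q$-tridendriform algebra of weight $\lambda$. *)

(* Defs.v *)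
From HB Require Import structures.
From Stdlib Require List.
From mathcomp Require Import all_boot all_algebra.
From mathcomp Require Import boolp finmap.
From mathcomp.multinomials Require Export monalg.

Set Implicit Arguments. Unset Strict Implicit. Unset Printing Implicit Defensive.
Import GRing.Theory.
Local Open Scope ring_scope.

(* Valently decorated Schroeder trees over Y, other than the trivial tree |. *)
(* A tree  \/^{m+1}_{x_1..x_m}(t^(0),...,t^(m))   (m >= 1)  is represented   *)
(*   NNode t0 [:: (x_1,t1); ...; (x_{m-1},t_{m-1})] x_m t_m                  *)
(* where each child is an  option ntree  (None = the tree |).               *)
(* So the root has m+1 >= 2 children and is decorated by (x_1,...,x_m).      *)
Section Trees.
Variable Y : Type.

Inductive ntree : Type :=
  NNode of option ntree & seq (Y * option ntree) & Y & option ntree.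

Definition oenc_with (e : ntree -> GenTree.tree Y) (o : option ntree) :=
  match o with None => GenTree.Node 1 [::] | Some u => e u end.

Fixpoint enc (t : ntree) : GenTree.tree Y :=
  match t with
  | NNode t0 mid ym tm =>
    GenTree.Node 0 (oenc_with enc t0 :: GenTree.Leaf ym :: oenc_with enc tm ::
      map (fun p => GenTree.Node 2 [:: GenTree.Leaf p.1; oenc_with enc p.2]) mid)
  end.

Definition odec_with (d : GenTree.tree Y -> option ntree) (h : GenTree.tree Y)
  : option (option ntree) :=
  match h with GenTree.Node 1 [::] => Some None | _ => omap Some (d h) end.

Fixpoint dec (g : GenTree.tree Y) : option ntree :=
  match g with
  | GenTree.Node 0 (a :: GenTree.Leaf y :: b :: r) =>
    let fix decl (r : seq (GenTree.tree Y)) : option (seq (Y * option ntree)) :=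
      match r with
      | [::] => Some [::]
      | GenTree.Node 2 [:: GenTree.Leaf y'; c] :: r' =>
          match odec_with dec c, decl r' with
          | Some oc, Some l => Some ((y', oc) :: l)
          | _, _ => None end
      | _ => None end in
    match odec_with dec a, odec_with dec b, decl r with
    | Some oa, Some ob, Some l => Some (NNode oa l y ob)
    | _, _, _ => None end
  | _ => None
  end.

Definition oP (P : ntree -> Prop) (o : option ntree) :=
  match o with None => True | Some t => P t end.

Lemma ntree_ind' (P : ntree -> Prop) :
  (forall t0 mid ym tm, oP P t0 -> List.Forall (fun p => oP P p.2) mid -> oP P tm ->
     P (NNode t0 mid ym tm)) -> forall t, P t.
Proof.
move=> H; fix IH 1 => -[t0 mid ym tm]; apply: H.
- by case: t0.
- elim: mid => [|[y [u|]] mid IHm]; constructor => //; exact: IH.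
- by case: tm.
Qed.

Lemma encK : pcancel enc dec.
Proof.
elim/ntree_ind' => t0 mid ym tm H0 Hm Hm'.
have oK o : oP (fun t => dec (enc t) = Some t) o ->
    odec_with dec (oenc_with enc o) = Some o.
  by case: o => [[a b c d] /= ->|//].
rewrite /= (oK _ H0) (oK _ Hm').
suff -> : (fix decl (r : seq (GenTree.tree Y)) : option (seq (Y * option ntree)) :=
      match r with
      | [::] => Some [::]
      | GenTree.Node 2 [:: GenTree.Leaf y'; c] :: r' =>
          match odec_with dec c, decl r' with
          | Some oc, Some l => Some ((y', oc) :: l)
          | _, _ => None end
      | _ => None end)
   (map (fun p => GenTree.Node 2 [:: GenTree.Leaf p.1; oenc_with enc p.2]) mid)
   = Some mid by [].
by elim: Hm => // -[y o] l Ho _ IHl /=; rewrite (oK _ Ho) IHl.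
Qed.
End Trees.

HB.instance Definition _ (Y : choiceType) :=
  Choice.copy (ntree Y) (pcan_type (@encK Y)).

Section Operations.
Variables (k : comNzRingType) (Y : choiceType) (q : k).

Local Notation tree := (ntree Y).
Local Notation DT := {malg k[tree]}.
Local Notation DTe := {malg k[option tree]}.

Definition liftO (c : DT) : DTe := \sum_(t <- msupp c) << c@_t *g Some t >>.

Definition graft (mk : option tree -> tree) (c : DTe) : DT :=
  \sum_(u <- msupp c) << c@_u *g mk u >>.

(* r = ((u < v, u > v), u . v)  |->  u *_q v *)
Definition starq (r : (DT * DT) * DT) : DT := r.1.1 + r.1.2 + q *: r.2.

(* ops t s = ((t < s, t > s), t . s) on basis trees, by the recursive formulas;
   | *_q s = s,  t *_q | = t,  | *_q | = |. *)
Fixpoint ops (t : tree) {struct t} : tree -> (DT * DT) * DT :=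
  let: NNode t0 tmid tx tm := t in
  fix ops_t (s : tree) {struct s} : (DT * DT) * DT :=
    let: NNode s0 smid sy sm := s in
    let prec := graft (fun u => NNode t0 tmid tx u)
        (match tm with
         | None => << Some s >>
         | Some a => liftO (starq (ops a s)) end) in
    let succ := graft (fun u => NNode u smid sy sm)
        (match s0 with
         | None => << Some t >>
         | Some b => liftO (starq (ops_t b)) end) in
    let bul := graft (fun u => NNode t0 (tmid ++ (tx, u) :: smid) sy sm)
        (match tm, s0 with
         | None, None => << None >>
         | None, Some b => << Some b >>
         | Some a, None => << Some a >>
         | Some a, Some b => liftO (starq (ops a b)) end) in
    ((prec, succ), bul).

Definition bilin (f : tree -> tree -> DT) (u v : DT) : DT :=
  \sum_(t <- msupp u) \sum_(s <- msupp v) (u@_t * v@_s) *: f t s.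

Definition precDT := bilin (fun t s => (ops t s).1.1).
Definition succDT := bilin (fun t s => (ops t s).1.2).
Definition bulDT  := bilin (fun t s => (ops t s).2).
End Operations.

Section Differential.
Variables (k : comNzRingType) (X : Type) (lam : k).

Definition DeltaX : choiceType := (classicType X * nat)%type.
Local Notation tree := (ntree DeltaX).
Local Notation DT := {malg k[tree]}.

Definition bump (y : DeltaX) : DeltaX := (y.1, y.2.+1).

(* independent choices, counting the number of bumped entries *)
Definition comb (A B C : Type) (f : A -> B -> C)
    (s : seq (nat * A)) (t : seq (nat * B)) : seq (nat * C) :=
  [seq (p.1 + r.1, f p.2 r.2) | p <- s, r <- t].

Definition choices (y : DeltaX) : seq (nat * DeltaX) := [:: (0, y); (1, bump y)].

Definition ovars_with (v : tree -> seq (nat * tree)) (o : option tree)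
  : seq (nat * option tree) :=
  match o with None => [:: (0, None)] | Some u => [seq (p.1, Some p.2) | p <- v u] end.

(* vars t lists, for every subset S of the decoration entries of t, the pair
   (|S|, t_S), where t_S has every entry x^(r) with index in S replaced by
   x^(r+1). *)
Fixpoint vars (t : tree) : seq (nat * tree) :=
  let: NNode t0 mid ym tm := t in
  let fix midvars (l : seq (DeltaX * option tree))
      : seq (nat * seq (DeltaX * option tree)) :=
      match l with
      | [::] => [:: (0, [::])]
      | (y, o) :: l' =>
          comb (fun y' rest => (y', rest.1) :: rest.2)
            (choices y) (comb pair (ovars_with vars o) (midvars l'))
      end in
  comb (fun u0 rest => NNode u0 rest.1 rest.2.1 rest.2.2)
    (ovars_with vars t0)
    (comb pair (midvars mid) (comb pair (choices ym) (ovars_with vars tm))).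

Definition dX_tree (t : tree) : DT :=
  \sum_(p <- vars t | (0 < p.1)%N) lam ^+ p.1.-1 *: << p.2 >>.

Definition dX (u : DT) : DT := \sum_(t <- msupp u) u@_t *: dX_tree t.

Definition jX (x : X) : DT := << NNode None [::] ((x : classicType X), 0%N) None >>.
End Differential.
Arguments dX {k} X lam u.

Section TriDend.
Variables (k : comNzRingType) (V : lmodType k).

Definition is_linear (W : lmodType k) (h : V -> W) :=
  forall (a : k) (u v : V), h (a *: u + v) = a *: h u + h v.

Definition is_bilinear (op : V -> V -> V) :=
  (forall u, is_linear (op u)) /\ (forall v, is_linear (fun u => op u v)).

Definition qtridend_axioms (q : k) (pr su bu : V -> V -> V) :=
  let st a b := su a b + pr a b + q *: bu a b in
  forall a b c : V,
  pr (pr a b) c = pr a (st b c) /\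
  pr (su a b) c = su a (pr b c) /\
  su (st a b) c = su a (su b c) /\
  bu (su a b) c = su a (bu b c) /\
  bu (pr a b) c = bu a (su b c) /\
  pr (bu a b) c = bu a (pr b c) /\
  bu (bu a b) c = bu a (bu b c).

Definition is_derivation (lam : k) (d : V -> V) (op : V -> V -> V) :=
  forall a b : V, d (op a b) = op (d a) b + op a (d b) + lam *: op (d a) (d b).

Definition diff_qtridend (q lam : k) (pr su bu : V -> V -> V) (d : V -> V) :=
  [/\ is_bilinear pr, is_bilinear su, is_bilinear bu,
      qtridend_axioms q pr su bu
    & is_linear d /\
      [/\ is_derivation lam d pr, is_derivation lam d su & is_derivation lam d bu]].
End TriDend.

Definition is_free_lift (k : comNzRingType) (X : Type) (lam q : k)
    (T : lmodType k) (pT sT bT : T -> T -> T) (dT : T -> T) (f : X -> T)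
    (fb : {malg k[ntree (DeltaX X)]} -> T) :=
  is_linear fb /\
  [/\ forall u v, fb (precDT q u v) = pT (fb u) (fb v),
      forall u v, fb (succDT q u v) = sT (fb u) (fb v),
      forall u v, fb (bulDT q u v) = bT (fb u) (fb v),
      forall u, dT (fb u) = fb (dX X lam u)
    & forall x, fb (jX k x) = f x].

(* Main.v *)
Require Import Defs.
From HB Require Import structures.
From mathcomp Require Import all_boot all_algebra.
From mathcomp Require Import boolp finmap.
From mathcomp.multinomials Require Import monalg.

(** Each of the seven relations at (t, s, r) reduces to associativity of the star
    product with t replaced by its last child or r by its first child, so they all
    follow by a nested induction. A tree is t_0 > ((x_1 < t_1) . .. . (x_m < t_m)),
    which determines the homomorphism extending a map on one-vertex trees, and its
    compatibility with the operations follows by the same nested induction.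

    A linear map d is a derivation of weight lam iff v |-> v + d(v) eps is a
    homomorphism into the extension of scalars by eps with eps^2 = lam eps. The
    homomorphism sending the one-vertex tree y to y + y' eps sends every tree to
    the sum of eps^|S| t_S over all subsets S of its entries, and the coefficient
    of eps in that sum is d_X(t). *)

Set Implicit Arguments. Unset Strict Implicit. Unset Printing Implicit Defensive.
Import GRing.Theory.
Local Open Scope ring_scope.

(** * Consequences of linearity for bare functions *)

Section IsLinear.
Variables (k : comNzRingType) (V W : lmodType k) (h : V -> W).
Hypothesis hL : is_linear h.

Lemma is_linearD u v : h (u + v) = h u + h v.
Proof. by have := hL 1 u v; rewrite !scale1r. Qed.

Lemma is_linear0 : h 0 = 0.
Proof. by apply: (addrI (h 0)); rewrite -is_linearD !addr0. Qed.

Lemma is_linearZ a u : h (a *: u) = a *: h u.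
Proof. by have := hL a u 0; rewrite is_linear0 !addr0. Qed.

Lemma is_linear_sum I (r : seq I) (P : pred I) F :
  h (\sum_(i <- r | P i) F i) = \sum_(i <- r | P i) h (F i).
Proof.
elim: r => [|i r IH]; first by rewrite !big_nil is_linear0.
by rewrite !big_cons; case: (P i) => //; rewrite is_linearD IH.
Qed.

End IsLinear.

(* Sealed, like [ostar] below: unification would otherwise unfold these sums. *)
HB.lock Definition lin (k : comNzRingType) (K : choiceType) (V : lmodType k)
    (f : K -> V) (u : {malg k[K]}) : V :=
  \sum_(t <- msupp u) u@_t *: f t.

(** * Linear extension from a basis *)

Section LinearExtension.
Variables (k : comNzRingType) (K : choiceType) (V : lmodType k).
Implicit Type f : K -> V.

(** Coefficients vanish outside the support, so sums over different supports can be compared on one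
    set containing them all. *)
Lemma lin_wide f (u : {malg k[K]}) (d : {fset K}) :
  (msupp u `<=` d)%fset -> lin f u = \sum_(t <- d) u@_t *: f t.
Proof.
move=> le; rewrite lin.unlock; apply: big_fset_incl => // x _ /mcoeff_outdom ->.
by rewrite scale0r.
Qed.

Lemma linP f : is_linear (lin f).
Proof.
move=> a u v.
pose d := (msupp (a *: u + v) `|` (msupp u `|` msupp v))%fset.
have hd w : (msupp w `<=` d)%fset -> lin f w = \sum_(t <- d) w@_t *: f t.
  exact: lin_wide.
have h1 : (msupp (a *: u + v) `<=` d)%fset by rewrite /d fsubsetUl.
have h2 : (msupp u `<=` d)%fset by rewrite /d fsetUCA fsubsetUl.
have h3 : (msupp v `<=` d)%fset by rewrite /d fsetUA fsubsetUr.
rewrite (hd _ h1) (hd _ h2) (hd _ h3).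
rewrite scaler_sumr -big_split /=; apply: eq_bigr => t _.
by rewrite mcoeffD mcoeffZ scalerDl scalerA.
Qed.

Lemma linU f t : lin f << t >> = f t.
Proof. by rewrite lin.unlock msuppU oner_eq0 big_seq_fset1 mcoeffUU scale1r. Qed.

Lemma malgU_scale (c : k) (t : K) : << c *g t >> = c *: << t >> :> {malg k[K]}.
Proof.
by apply/malgP => s; rewrite mcoeffZ !mcoeffU mulr_natr.
Qed.

Lemma malg_sum_basis (u : {malg k[K]}) : u = \sum_(t <- msupp u) u@_t *: << t >>.
Proof. by rewrite {1}[u]monalgE; apply: eq_bigr => t _; rewrite malgU_scale. Qed.

(** The tool for all reductions to basis trees below; multilinear identities are treated one
    variable at a time. *)
Lemma lin_ext (g h : {malg k[K]} -> V) : is_linear g -> is_linear h ->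
  (forall t, g << t >> = h << t >>) -> forall u, g u = h u.
Proof.
move=> gL hL e u; rewrite [u]malg_sum_basis (is_linear_sum gL) (is_linear_sum hL).
by apply: eq_bigr => t _; rewrite (is_linearZ gL) (is_linearZ hL) e.
Qed.

End LinearExtension.

Lemma lin_linearr (k : comNzRingType) (K : choiceType) (V W : lmodType k)
    (f : K -> V -> W) (u : {malg k[K]}) :
  (forall t, is_linear (f t)) -> is_linear (fun v => lin (f^~ v) u).
Proof.
move=> fL a x y; rewrite lin.unlock scaler_sumr -big_split; apply: eq_bigr => t _ /=.
by rewrite fL scalerDr !scalerA (mulrC a).
Qed.

(** * The tridendriform relations as mixed associativity laws *)

Section MixedAssociativity.
Variables (k : comNzRingType) (V : lmodType k).
Implicit Types o : V -> V -> V.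

(** The common shape of the seven relations, so that trilinear extension and extension of scalars
    are proved once for all of them. *)
Definition mixed_assoc o1 o2 o3 o4 :=
  forall a b c, o2 (o1 a b) c = o3 a (o4 b c).

Definition star_op (q : k) (pr su bu : V -> V -> V) a b :=
  su a b + pr a b + q *: bu a b.

Lemma star_op_bilinear q pr su bu :
  is_bilinear pr -> is_bilinear su -> is_bilinear bu ->
  is_bilinear (star_op q pr su bu).
Proof.
move=> [p1 p2] [s1 s2] [b1 b2].
have E (a : k) (x y z x' y' z' : V) :
    (a *: x + x') + (a *: y + y') + q *: (a *: z + z') =
    a *: (x + y + q *: z) + (x' + y' + q *: z').
  rewrite addrACA -scalerDr [q *: (_ + _)]scalerDr addrACA; congr (_ + _).
  by rewrite !scalerDr !scalerA (mulrC q).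
split=> u a v w; rewrite /star_op; first by rewrite p1 s1 b1 E.
by rewrite (p2 u a) (s2 u a) (b2 u a) E.
Qed.

Lemma qtridend_mixed q pr su bu :
  (let st := star_op q pr su bu in
   [/\ [/\ mixed_assoc pr pr pr st, mixed_assoc su pr su pr & mixed_assoc st su su su]
     & [/\ mixed_assoc su bu su bu, mixed_assoc pr bu bu su,
           mixed_assoc bu pr bu pr & mixed_assoc bu bu bu bu]])
  <-> qtridend_axioms q pr su bu.
Proof.
split.
  move=> [[h1 h2 h3] [h4 h5 h6 h7]] st a b c.
  exact: (conj (h1 a b c) (conj (h2 a b c) (conj (h3 a b c) (conj (h4 a b c)
    (conj (h5 a b c) (conj (h6 a b c) (h7 a b c))))))).
by move=> h; split; split=> a b c; case: (h a b c) => ? [? [? [? [? []]]]].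
Qed.

(** The relations at a single triple, the form in which an induction on trees can provide them. *)
Definition qtridend_at q pr su bu a b c :=
  let st := star_op q pr su bu in
  [/\ [/\ pr (pr a b) c = pr a (st b c), pr (su a b) c = su a (pr b c)
        & su (st a b) c = su a (su b c)]
    & [/\ bu (su a b) c = su a (bu b c), bu (pr a b) c = bu a (su b c),
          pr (bu a b) c = bu a (pr b c) & bu (bu a b) c = bu a (bu b c)]].

(** Expanding the outer and inner stars of one bracketing gives the left sides of the seven
    relations with weights 1, 1, 1, q, q, q, q^2; the right sides with the same weights make up the
    other bracketing. *)
Lemma star_op_assoc_at q pr su bu a b c :
  is_bilinear pr -> is_bilinear su -> is_bilinear bu ->
  qtridend_at q pr su bu a b c ->
  let st := star_op q pr su bu in st (st a b) c = st a (st b c).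
Proof.
move=> [p1 p2] [s1 s2] [b1 b2] [[h1 h2 h3] [h4 h5 h6 h7]] st.
have stl o : is_linear (o^~ c) ->
    o (st a b) c = o (su a b) c + o (pr a b) c + q *: o (bu a b) c.
  by move=> oL; rewrite (is_linearD oL) (is_linearD oL) (is_linearZ oL).
have str o : is_linear (o a) ->
    o a (st b c) = o a (su b c) + o a (pr b c) + q *: o a (bu b c).
  by move=> oL; rewrite (is_linearD oL) (is_linearD oL) (is_linearZ oL).
have -> : st (st a b) c = su (st a b) c + pr (st a b) c + q *: bu (st a b) c by [].
rewrite h3 (stl _ (p2 c)) (stl _ (b2 c)) h1 h2 h4 h5 h6 h7.
have -> : st a (st b c) = su a (st b c) + pr a (st b c) + q *: bu a (st b c) by [].
rewrite (str _ (s1 a)) (str _ (b1 a)) !scalerDr -!addrA; congr (_ + _).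
congr (_ + _). rewrite [RHS]addrCA; congr (_ + _). 
by rewrite [LHS]addrCA; congr (_ + _); rewrite [LHS]addrCA.
Qed.

End MixedAssociativity.

Lemma star_op_hom_at (k : comNzRingType) (V W : lmodType k) q
    (pr su bu : V -> V -> V) (pr' su' bu' : W -> W -> W) (g : V -> W) a b :
  is_linear g -> g (pr a b) = pr' (g a) (g b) -> g (su a b) = su' (g a) (g b) ->
  g (bu a b) = bu' (g a) (g b) ->
  g (star_op q pr su bu a b) = star_op q pr' su' bu' (g a) (g b).
Proof.
by move=> gL h1 h2 h3; rewrite /star_op !(is_linearD gL) (is_linearZ gL) h1 h2 h3.
Qed.

Lemma mixed_assoc_ext (k : comNzRingType) (K : choiceType)
    (o1 o2 o3 o4 : {malg k[K]} -> {malg k[K]} -> {malg k[K]}) :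
  is_bilinear o1 -> is_bilinear o2 -> is_bilinear o3 -> is_bilinear o4 ->
  (forall t s r, o2 (o1 << t >> << s >>) << r >> = o3 << t >> (o4 << s >> << r >>)) ->
  mixed_assoc o1 o2 o3 o4.
Proof.
move=> [l1 r1] [l2 r2] [l3 r3] [l4 r4] e a b c.
move: a; apply: lin_ext => [x u v|x u v|t].
- by rewrite (r1 b) (r2 c).
- by rewrite (r3 _ x).
move: b; apply: lin_ext => [x u v|x u v|s].
- by rewrite l1 (r2 c).
- by rewrite (r4 c) l3.
move: c; apply: lin_ext => [x u v|x u v|r].
- by rewrite l2.
- by rewrite l4 l3.
exact: e.
Qed.

(** * Inclusion into the unitization, grafting and bilinear extension *)

HB.lock Definition dlift (k : comNzRingType) (Y : choiceType)
    (c : {malg k[ntree Y]}) : {malg k[option (ntree Y)]} :=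
  lin (fun t => << Some t >>) c.

Section LiftGraft.
Variables (k : comNzRingType) (Y : choiceType).
Local Notation tree := (ntree Y).
Local Notation DT := {malg k[tree]}.
Local Notation DTe := {malg k[option tree]}.

Lemma dliftE (c : DT) : dlift c = liftO c.
Proof.
by rewrite dlift.unlock lin.unlock; apply: eq_bigr => t _; rewrite malgU_scale.
Qed.

Lemma dlift_linear : is_linear (@dlift k Y).
Proof. by move=> a u v; rewrite dlift.unlock linP. Qed.

Lemma dliftU t : dlift (<< t >> : DT) = << Some t >>.
Proof. by rewrite dlift.unlock linU. Qed.

Lemma graftE mk (c : DTe) : graft mk c = lin (fun o => << mk o >> : DT) c.
Proof. by rewrite lin.unlock; apply: eq_bigr => t _; rewrite malgU_scale. Qed.

Lemma graft_linear mk : is_linear (@graft k Y mk).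
Proof. by move=> a u v; rewrite !graftE linP. Qed.

Lemma graftU mk o : graft mk (<< o >> : DTe) = << mk o >>.
Proof. by rewrite graftE linU. Qed.

(** Grafting in two slots at once, extended bilinearly: in several relations two different children
    are multiplied independently. *)
Definition graft2 (mk : option tree -> option tree -> tree) (e e' : DTe) : DT :=
  lin (fun o => graft (mk o) e') e.

Lemma graft2_linearl mk e' : is_linear (graft2 mk ^~ e').
Proof. exact: linP. Qed.

Lemma graft2Ul mk o e' : graft2 mk << o >> e' = graft (mk o) e'.
Proof. exact: linU. Qed.

Lemma graft2_linearr mk e : is_linear (graft2 mk e).
Proof.
apply: (lin_linearr (f := fun o => graft (mk o))) => o; exact: graft_linear.
Qed.

Lemma graft2Ur mk e o : graft2 mk e << o >> = graft (mk^~ o) e.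
Proof.
move: e; apply: lin_ext => [||p].
- exact: graft2_linearl.
- exact: graft_linear.
by rewrite graft2Ul !graftU.
Qed.

Lemma bilinE f (u v : DT) : bilin f u v = lin (fun t => lin (f t) v) u.
Proof.
rewrite lin.unlock; apply: eq_bigr => t _; rewrite scaler_sumr.
by apply: eq_bigr => s _; rewrite scalerA.
Qed.

Lemma bilinU f t s : bilin f (<< t >> : DT) << s >> = f t s.
Proof. by rewrite bilinE !linU. Qed.

Lemma bilin_bilinear (f : tree -> tree -> DT) : is_bilinear (bilin f).
Proof.
split=> u; last by move=> a x y; rewrite !bilinE linP.
move=> a x y; rewrite !bilinE; apply: (lin_linearr (f := fun t => lin (f t))) => t.
exact: linP.
Qed.

End LiftGraft.

(** * The star product on trees and on the unitization *)

HB.lock Definition starDT (k : comNzRingType) (Y : choiceType) (q : k) :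
    {malg k[ntree Y]} -> {malg k[ntree Y]} -> {malg k[ntree Y]} :=
  star_op q (precDT q) (succDT q) (bulDT q).

Section TreeOperations.
Variables (k : comNzRingType) (Y : choiceType) (q : k).
Local Notation tree := (ntree Y).
Local Notation DT := {malg k[tree]}.
Local Notation DTe := {malg k[option tree]}.

Lemma precDT_bilinear : is_bilinear (@precDT k Y q).
Proof. exact: bilin_bilinear. Qed.

Lemma succDT_bilinear : is_bilinear (@succDT k Y q).
Proof. exact: bilin_bilinear. Qed.

Lemma bulDT_bilinear : is_bilinear (@bulDT k Y q).
Proof. exact: bilin_bilinear. Qed.

Local Notation starDT := (@starDT k Y q).

Lemma starDTE u v : starDT u v = star_op q (precDT q) (succDT q) (bulDT q) u v.
Proof. by rewrite starDT.unlock. Qed.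

Lemma starDT_bilinear : is_bilinear starDT.
Proof.
rewrite starDT.unlock; exact: star_op_bilinear precDT_bilinear succDT_bilinear bulDT_bilinear.
Qed.

Lemma starDTU t s : starDT << t >> << s >> = starq q (ops q t s).
Proof.
rewrite starDTE /star_op /precDT /succDT /bulDT !bilinU /starq.
by rewrite [X in X + _]addrC.
Qed.

End TreeOperations.

(* The product *_q on the unitization of DT, spanned by all trees including |. *)
HB.lock Definition ostar (k : comNzRingType) (Y : choiceType) (q : k)
    (e e' : {malg k[option (ntree Y)]}) : {malg k[option (ntree Y)]} :=
  lin (fun o => lin (fun o' : option (ntree Y) => match o, o' with
    | None, _ => << o' >>
    | _, None => << o >>
    | Some t, Some s => dlift (starDT q << t >> << s >>)
    end) e') e.

Section OptionTrees.
Variables (k : comNzRingType) (Y : choiceType) (q : k).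
Local Notation tree := (ntree Y).
Local Notation DT := {malg k[tree]}.
Local Notation DTe := {malg k[option tree]}.
Local Notation ostar := (@ostar k Y q).
Local Notation starDT := (@starDT k Y q).

Lemma ostar_bilinear : is_bilinear ostar.
Proof.
rewrite ostar.unlock; split=> u; last exact: linP.
by apply: lin_linearr => o; exact: linP.
Qed.

Lemma ostarSS t s :
  ostar << Some t >> << Some s >> = dlift (starDT << t >> << s >>).
Proof. by rewrite ostar.unlock !linU. Qed.

Lemma ostar1l e : ostar << None >> e = e.
Proof.
move: e; apply: lin_ext => [||o]; first exact: ostar_bilinear.1.
- by move=> a x y.
by rewrite ostar.unlock !linU.
Qed.

Lemma ostar1r e : ostar e << None >> = e.
Proof.
move: e; apply: lin_ext => [||o]; first exact: ostar_bilinear.2.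
- by move=> a x y.
by rewrite ostar.unlock !linU; case: o.
Qed.

Lemma ostar_lift u v : ostar (dlift u) (dlift v) = dlift (starDT u v).
Proof.
move: u; apply: lin_ext => [a x y|a x y|t].
- by rewrite dlift_linear (ostar_bilinear.2 _ a).
- by rewrite ((starDT_bilinear Y q).2 _ a) dlift_linear.
move: v; apply: lin_ext => [a x y|a x y|s].
- by rewrite dlift_linear (ostar_bilinear.1 _ a).
- by rewrite ((starDT_bilinear Y q).1 _ a) dlift_linear.
by rewrite !dliftU ostarSS.
Qed.

(** In this formula and the next two, the case distinctions of [ops] on trivial children disappear
    because | is the unit of [ostar]. *)
Lemma precDTU t0 mid x tm s :
  precDT q << NNode t0 mid x tm >> << s >> =
  graft (NNode t0 mid x) (ostar << tm >> << Some s >>).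
Proof.
rewrite /precDT bilinU; case: s => s0 mid' y sm.
case: tm => [a|]; last by rewrite ostar1l.
by rewrite ostarSS starDTU dliftE.
Qed.

Lemma succDTU t s0 mid y sm :
  succDT q << t >> << NNode s0 mid y sm >> =
  graft (fun o => NNode o mid y sm) (ostar << Some t >> << s0 >>).
Proof.
rewrite /succDT bilinU; case: t => t0 mid' x tm.
case: s0 => [b|]; last by rewrite ostar1r.
by rewrite ostarSS starDTU dliftE.
Qed.

Lemma bulDTU t0 mid x tm s0 mid' y sm :
  bulDT q << NNode t0 mid x tm >> << NNode s0 mid' y sm >> =
  graft (fun o => NNode t0 (mid ++ (x, o) :: mid') y sm) (ostar << tm >> << s0 >>).
Proof.
rewrite /bulDT bilinU; case: tm => [a|].
  case: s0 => [b|]; last by rewrite ostar1r.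
  by rewrite ostarSS starDTU dliftE.
by rewrite ostar1l; case: s0.
Qed.

End OptionTrees.

(** * The tridendriform relations for trees *)

Section TreeAxioms.
Variables (k : comNzRingType) (Y : choiceType) (q : k).
Local Notation tree := (ntree Y).
Local Notation otree := (option tree).
Local Notation DT := {malg k[tree]}.
Local Notation DTe := {malg k[otree]}.
Local Notation pr := (precDT q).
Local Notation su := (succDT q).
Local Notation bu := (bulDT q).
Local Notation st := (starDT q).
Implicit Types (o : otree) (u v : DT) (e : DTe) (x y z : Y).
Implicit Types (mid : seq (Y * otree)) (A S : otree -> otree) (M : otree -> seq (Y * otree)).

Let prl v : is_linear (pr^~ v). Proof. exact: (precDT_bilinear Y q).2. Qed.
Let prr v : is_linear (pr v). Proof. exact: (precDT_bilinear Y q).1. Qed.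
Let sul v : is_linear (su^~ v). Proof. exact: (succDT_bilinear Y q).2. Qed.
Let sur v : is_linear (su v). Proof. exact: (succDT_bilinear Y q).1. Qed.
Let bul v : is_linear (bu^~ v). Proof. exact: (bulDT_bilinear Y q).2. Qed.
Let bur v : is_linear (bu v). Proof. exact: (bulDT_bilinear Y q).1. Qed.
Let osl e : is_linear (ostar q ^~ e). Proof. exact: (ostar_bilinear Y q).2. Qed.
Let osr e : is_linear (ostar q e). Proof. exact: (ostar_bilinear Y q).1. Qed.

Lemma prec_graft_last t0 mid x e v :
  pr (graft (NNode t0 mid x) e) v = graft (NNode t0 mid x) (ostar q e (dlift v)).
Proof.
move: e; apply: lin_ext => [a i j|a i j|o].
- by rewrite graft_linear (prl v).
- by rewrite (osl _ a) graft_linear.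
move: v; apply: lin_ext => [a i j|a i j|s].
- exact: prr.
- by rewrite dlift_linear osr graft_linear.
by rewrite graftU precDTU dliftU.
Qed.

(** Here the grafted slot lies before the last child, in a place recorded by [A] and [M]. The
    product acts on the last child only, so the result is a double graft. *)
Lemma prec_graft A M y sm e v :
  pr (graft (fun o => NNode (A o) (M o) y sm) e) v =
  graft2 (fun o o' => NNode (A o) (M o) y o') e (ostar q << sm >> (dlift v)).
Proof.
move: e; apply: lin_ext => [a i j|a i j|o].
- by rewrite graft_linear (prl v).
- exact: graft2_linearl.
rewrite graft2Ul graftU; move: v; apply: lin_ext => [a i j|a i j|s].
- exact: prr.
- by rewrite dlift_linear osr graft_linear.
by rewrite precDTU dliftU.
Qed.

Lemma succ_graft_first mid y sm e u :
  su u (graft (fun o => NNode o mid y sm) e) =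
  graft (fun o => NNode o mid y sm) (ostar q (dlift u) e).
Proof.
move: e; apply: lin_ext => [a i j|a i j|o].
- by rewrite graft_linear sur.
- by rewrite osr graft_linear.
move: u; apply: lin_ext => [a i j|a i j|t].
- exact: sul.
- by rewrite dlift_linear (osl _ a) graft_linear.
by rewrite graftU succDTU dliftU.
Qed.

Lemma succ_graft M S y s0 e u :
  su u (graft (fun o => NNode s0 (M o) y (S o)) e) =
  graft2 (fun o o' => NNode o (M o') y (S o')) (ostar q (dlift u) << s0 >>) e.
Proof.
move: e; apply: lin_ext => [a i j|a i j|o].
- by rewrite graft_linear sur.
- exact: graft2_linearr.
rewrite graft2Ur graftU; move: u; apply: lin_ext => [a i j|a i j|t].
- exact: sul.
- by rewrite dlift_linear (osl _ a) graft_linear.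
by rewrite succDTU dliftU.
Qed.

Lemma bul_graft_last t0 mid x s0 mid' y sm e :
  bu (graft (NNode t0 mid x) e) << NNode s0 mid' y sm >> =
  graft (fun o => NNode t0 (mid ++ (x, o) :: mid') y sm) (ostar q e << s0 >>).
Proof.
move: e; apply: lin_ext => [a i j|a i j|o].
- by rewrite graft_linear (bul _ a).
- by rewrite (osl _ a) graft_linear.
by rewrite graftU bulDTU.
Qed.

Lemma bul_graft_first t0 mid x tm mid' y sm e :
  bu << NNode t0 mid x tm >> (graft (fun o => NNode o mid' y sm) e) =
  graft (fun o => NNode t0 (mid ++ (x, o) :: mid') y sm) (ostar q << tm >> e).
Proof.
move: e; apply: lin_ext => [a i j|a i j|o].
- by rewrite graft_linear bur.
- by rewrite osr graft_linear.
by rewrite graftU bulDTU.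
Qed.

Lemma bul_graftl A M y sm r0 mid z rm e :
  bu (graft (fun o => NNode (A o) (M o) y sm) e) << NNode r0 mid z rm >> =
  graft2 (fun o o' => NNode (A o) (M o ++ (y, o') :: mid) z rm) e
         (ostar q << sm >> << r0 >>).
Proof.
move: e; apply: lin_ext => [a i j|a i j|o].
- by rewrite graft_linear (bul _ a).
- exact: graft2_linearl.
by rewrite graft2Ul graftU bulDTU.
Qed.

Lemma bul_graftr M S t0 mid x tm s0 y e :
  bu << NNode t0 mid x tm >> (graft (fun o => NNode s0 (M o) y (S o)) e) =
  graft2 (fun o o' => NNode t0 (mid ++ (x, o) :: M o') y (S o'))
         (ostar q << tm >> << s0 >>) e.
Proof.
move: e; apply: lin_ext => [a i j|a i j|o].
- by rewrite graft_linear bur.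
- exact: graft2_linearr.
by rewrite graft2Ur graftU bulDTU.
Qed.

Definition assoc_at (t s r : tree) : Prop :=
  st (st << t >> << s >>) << r >> = st << t >> (st << s >> << r >>).

(** If an outer factor is |, both bracketings agree by the unit law; only nontrivial outer factors
    call for [assoc_at]. *)
Lemma ostar_assoc_of o s o' :
  oP (fun t => oP (assoc_at t s) o') o ->
  ostar q (ostar q << o >> << Some s >>) << o' >> =
  ostar q << o >> (ostar q << Some s >> << o' >>).
Proof.
case: o => [t|]; last by move=> _; rewrite !ostar1l.
case: o' => [r|]; last first.
  move=> _; exact: etrans (ostar1r q _) (congr1 (ostar q _) (esym (ostar1r q _))).
move=> e. 
rewrite -(dliftU k t) -(dliftU k s) -(dliftU k r).
rewrite !ostar_lift.
have {}e : assoc_at t s r := e.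
by rewrite e.
Qed.

(* The seven relations at (t, s, r) only involve the associativity of the star
   product with t replaced by its last child or r by its first child. *)
Lemma qtridend_step t s r :
  (let: NNode _ _ _ tm := t in let: NNode r0 _ _ _ := r in
   [/\ oP (fun t' => assoc_at t' s r) tm, oP (assoc_at t s) r0
     & oP (fun t' => oP (assoc_at t' s) r0) tm]) ->
  qtridend_at q pr su bu << t >> << s >> << r >>.
Proof.
case: t => t0 mid x tm; case: r => r0 mid2 z rm; case: s => s0 mid1 y sm [h1 h2 h3].
set s := NNode s0 mid1 y sm; set r := NNode r0 mid2 z rm; set t := NNode t0 mid x tm.
have st_lift (u v : DT) : dlift (star_op q pr su bu u v) = ostar q (dlift u) (dlift v).
  by rewrite ostar_lift starDTE.
split; split.
(* Both sides graft onto the last child of [t], and agree by associativity at [tm], [s], [r]. *)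
- rewrite /t precDTU prec_graft_last dliftU.
  rewrite (ostar_assoc_of (o' := Some r)) //.
  rewrite -(dliftU k s) -(dliftU k r) -st_lift.
  by rewrite -(graftU k (NNode t0 mid x)) prec_graft_last.
(* Both sides are the same double graft, onto the first and the last child of [s]. *)
- rewrite /s succDTU (prec_graft id (fun=> mid1)) precDTU.
  by rewrite (succ_graft (fun=> mid1) id) !dliftU.
- rewrite /r !succDTU succ_graft_first.
  rewrite -(graftU k (fun o => NNode o mid2 z rm)) succ_graft_first st_lift !dliftU.
  by congr graft; apply: (ostar_assoc_of (o := Some t)).
- rewrite /s /r succDTU (bul_graftl id (fun=> mid1)) bulDTU.
  by rewrite (succ_graft (fun o => mid1 ++ (y, o) :: mid2) (fun=> rm)) dliftU.
(* The single slot where [t] and [r] are joined receives the two bracketings of the product of [tm],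
   [s] and [r0]. *)
- rewrite /t /r precDTU bul_graft_last succDTU bul_graft_first.
  by congr graft; apply: ostar_assoc_of.
- rewrite /t /s bulDTU (prec_graft (fun=> t0) (fun o => mid ++ (x, o) :: mid1)).
  by rewrite precDTU (bul_graftr (fun=> mid1) id) dliftU.
- rewrite /t /s /r !bulDTU (bul_graftl (fun=> t0) (fun o => mid ++ (x, o) :: mid1)).
  rewrite (bul_graftr (fun o => mid1 ++ (y, o) :: mid2) (fun=> rm)).
  (* The double grafts differ only in the bracketing of the concatenated lists of middle
     children. *)
  by congr graft2; do 2![apply: funext => ?]; rewrite -catA.
Qed.

Lemma star_assoc_of t s r :
  qtridend_at q pr su bu << t >> << s >> << r >> -> assoc_at t s r.
Proof.
move=> h; rewrite /assoc_at !starDTE; apply: (star_op_assoc_at _ _ _ h).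
- exact: precDT_bilinear.
- exact: succDT_bilinear.
- exact: bulDT_bilinear.
Qed.

(** Induction on [t] for all [r], then on [r], with [s] fixed. The outer hypothesis covers the last
    child of [t] against both [r] and its first child; the inner one covers [t] against the first
    child of [r]. *)
Lemma starDT_assocU t s r : assoc_at t s r.
Proof.
elim/ntree_ind': t r => t0 mid x tm _ _ IHt.
elim/ntree_ind' => r0 mid' z rm IHr _ _.
apply: star_assoc_of; apply: qtridend_step; split; last 1 first.
- by case: tm IHt {IHr} => //= t IHt; case: r0 => //= r; apply: IHt.
- by case: tm IHt {IHr} => //= t IHt; apply: IHt.
exact: IHr.
Qed.

Lemma qtridend_DT :
  qtridend_axioms q (@precDT k Y q) (@succDT k Y q) (@bulDT k Y q).
Proof.
have pb := precDT_bilinear Y q; have sb := succDT_bilinear Y q.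
have bb := bulDT_bilinear Y q.
have stb := star_op_bilinear q pb sb bb.
have h (t s r : tree) : qtridend_at q pr su bu << t >> << s >> << r >>.
  apply: qtridend_step; case: t => t0 mid x tm; case: r => r0 mid' z rm.
  split; case: tm => //= *; case: r0 => //= *; exact: starDT_assocU.
apply/qtridend_mixed; split; split.
- apply: (mixed_assoc_ext pb pb pb stb) => t s r; case: (h t s r) => -[e _ _] _; exact: e.
- apply: (mixed_assoc_ext sb pb sb pb) => t s r; case: (h t s r) => -[_ e _] _; exact: e.
- apply: (mixed_assoc_ext stb sb sb sb) => t s r; case: (h t s r) => -[_ _ e] _; exact: e.
- apply: (mixed_assoc_ext sb bb sb bb) => t s r; case: (h t s r) => _ [e _ _ _]; exact: e.
- apply: (mixed_assoc_ext pb bb bb sb) => t s r; case: (h t s r) => _ [_ e _ _]; exact: e.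
- apply: (mixed_assoc_ext bb pb bb pb) => t s r; case: (h t s r) => _ [_ _ e _]; exact: e.
- apply: (mixed_assoc_ext bb bb bb bb) => t s r; case: (h t s r) => _ [_ _ _ e]; exact: e.
Qed.

End TreeAxioms.

(** * Generation by one-vertex trees *)

Section Generation.
Variables (k : comNzRingType) (Y : choiceType) (q : k).
Local Notation DT := {malg k[ntree Y]}.

Definition corolla (y : Y) : ntree Y := NNode None [::] y None.

(** Induction along the decomposition t_0 > ((x_1 < t_1) . .. . (x_m < t_m)): the last three cases
    split off a factor of <, of . and of > respectively. *)
Lemma ntree_ind_generated (P : ntree Y -> Prop) :
  (forall y, P (corolla y)) ->
  (forall x t, P t -> P (NNode None [::] x (Some t))) ->
  (forall x o mid y tm, P (NNode None [::] x o) -> P (NNode None mid y tm) ->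
     P (NNode None ((x, o) :: mid) y tm)) ->
  (forall b mid y tm, P b -> P (NNode None mid y tm) ->
     P (NNode (Some b) mid y tm)) ->
  forall t, P t.
Proof.
move=> Pgen Plast Pmid Pfirst; elim/ntree_ind' => t0 mid y tm P0 Pm Ptm.
have Pnode x o : oP P o -> P (NNode None [::] x o).
  by case: o => [t|] Po; [apply: Plast | apply: Pgen].
have PN : P (NNode None mid y tm).
  elim: Pm => [|[x o] mid' Po _ IH]; first exact: Pnode.
  by apply: Pmid => //; apply: Pnode.
by case: t0 P0 => [b|] Pb //; apply: Pfirst.
Qed.

Lemma NNode_prec x t :
  << NNode None [::] x (Some t) >> = precDT q << corolla x >> << t >> :> DT.
Proof. by rewrite precDTU ostar1l graftU. Qed.

Lemma NNode_bul x o mid y tm :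
  << NNode None ((x, o) :: mid) y tm >> =
  bulDT q << NNode None [::] x o >> << NNode None mid y tm >> :> DT.
Proof. by rewrite bulDTU ostar1r graftU. Qed.

Lemma NNode_succ b mid y tm :
  << NNode (Some b) mid y tm >> = succDT q << b >> << NNode None mid y tm >> :> DT.
Proof. by rewrite succDTU ostar1r graftU. Qed.

(** Each basis tree is a single product of smaller ones, so closure under the three operations
    reaches all of them. *)
Lemma DT_generated (P : DT -> Prop) :
  (forall y, P << corolla y >>) ->
  (forall u v, P u -> P v -> P (precDT q u v)) ->
  (forall u v, P u -> P v -> P (succDT q u v)) ->
  (forall u v, P u -> P v -> P (bulDT q u v)) ->
  forall t, P << t >>.
Proof.
move=> Pgen Ppr Psu Pbu; apply: ntree_ind_generated => [||x o mid y tm|b mid y tm].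
- exact: Pgen.
- by move=> x t Pt; rewrite NNode_prec; exact: Ppr (Pgen x) Pt.
- by rewrite NNode_bul; exact: Pbu.
- by rewrite NNode_succ; exact: Psu.
Qed.

End Generation.

(** * The homomorphism extending a map on one-vertex trees *)

Section Lift.
Variables (k : comNzRingType) (Y : choiceType) (q : k).
Local Notation tree := (ntree Y).
Local Notation otree := (option tree).
Local Notation DT := {malg k[tree]}.
Local Notation DTe := {malg k[otree]}.
Variables (T : lmodType k) (pT sT bT : T -> T -> T) (f : Y -> T).
Hypotheses (pTb : is_bilinear pT) (sTb : is_bilinear sT) (bTb : is_bilinear bT).
Hypothesis (Tax : qtridend_axioms q pT sT bT).
Implicit Types (c d : T) (o : otree) (e : DTe) (x y : Y) (mid : seq (Y * otree)).

(* The tree with root children t_0, .., t_m and root decoration (x_1, .., x_m) is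
   t_0 > ((x_1 < t_1) . (x_2 < t_2) . .. . (x_m < t_m)). *)
Fixpoint tree_lift (t : tree) : T :=
  let: NNode t0 mid y tm := t in
  let pO c o := if o is Some u then pT c (tree_lift u) else c in
  let c := foldr (fun p => bT (pO (f p.1) p.2)) (pO (f y) tm) mid in
  if t0 is Some b then sT (tree_lift b) c else c.

Definition DT_lift : DT -> T := lin tree_lift.

(** The building blocks of [tree_lift], with | acting as the identity; [pE] and [sE] extend them
    linearly to the unitization. *)
Let pO c o := if o is Some u then pT c (tree_lift u) else c.
Let sO o c := if o is Some u then sT (tree_lift u) c else c.
Let chain mid c := foldr (fun p => bT (pO (f p.1) p.2)) c mid.
Let pE c e := lin (pO c) e.
Let sE e c := lin (sO^~ c) e.

Let tree_liftE t0 mid y tm :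
  tree_lift (NNode t0 mid y tm) = sO t0 (chain mid (pO (f y) tm)).
Proof. by case: t0. Qed.

Let sO_linear o : is_linear (sO o).
Proof. by case: o => [u|] //=; exact: sTb.1. Qed.

Let chain_linear mid : is_linear (chain mid).
Proof. by elim: mid => [|p mid IH] a c d //=; rewrite IH bTb.1. Qed.

Let pE_dlift c v : pE c (dlift v) = pT c (DT_lift v).
Proof.
move: v; apply: lin_ext => [a i j|a i j|t].
- by rewrite dlift_linear [LHS]linP.
- by rewrite [DT_lift _]linP pTb.1.
by rewrite dliftU /pE /DT_lift !linU.
Qed.

Let sE_dlift c v : sE (dlift v) c = sT (DT_lift v) c.
Proof.
move: v; apply: lin_ext => [a i j|a i j|t].
- by rewrite dlift_linear [LHS]linP.
- by rewrite [DT_lift _]linP (sTb.2 _ a).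
by rewrite dliftU /sE /DT_lift !linU.
Qed.

Let lift_graft_last t0 mid y e :
  DT_lift (graft (NNode t0 mid y) e) = sO t0 (chain mid (pE (f y) e)).
Proof.
move: e; apply: lin_ext => [a i j|a i j|o].
- by rewrite graft_linear [LHS]linP.
- by rewrite [pE _ _]linP chain_linear sO_linear.
by rewrite graftU /pE /DT_lift !linU tree_liftE.
Qed.

Let lift_graft_first mid y tm e :
  DT_lift (graft (fun o => NNode o mid y tm) e) = sE e (chain mid (pO (f y) tm)).
Proof.
move: e; apply: lin_ext => [a i j|a i j|o].
- by rewrite graft_linear [LHS]linP.
- exact: linP.
by rewrite graftU /sE /DT_lift !linU tree_liftE.
Qed.

Let chain_cat mid mid' c : chain (mid ++ mid') c = chain mid (chain mid' c).
Proof. exact: foldr_cat. Qed.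

Let lift_graft_mid t0 mid x mid' y sm e :
  DT_lift (graft (fun o => NNode t0 (mid ++ (x, o) :: mid') y sm) e) =
  sO t0 (chain mid (bT (pE (f x) e) (chain mid' (pO (f y) sm)))).
Proof.
move: e; apply: lin_ext => [a i j|a i j|o].
- by rewrite graft_linear [LHS]linP.
- by rewrite [pE _ _]linP (bTb.2 _ a) chain_linear sO_linear.
by rewrite graftU /pE /DT_lift !linU tree_liftE chain_cat.
Qed.

Let Tmx := (qtridend_mixed q pT sT bT).2 Tax.

(** This fact and the next three move the left factors of a lifted tree out of a product, so that
    the product acts on the last factor only. *)
Let pT_sO o c d : pT (sO o c) d = sO o (pT c d).
Proof. by case: o => [u|] //=; case: Tmx => -[_ h _] _; exact: h. Qed.

Let bT_sO o c d : bT (sO o c) d = sO o (bT c d).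
Proof. by case: o => [u|] //=; case: Tmx => _ [h _ _ _]; exact: h. Qed.

Let pT_chain mid c d : pT (chain mid c) d = chain mid (pT c d).
Proof.
case: Tmx => _ [_ _ h _].
by elim: mid => [|p mid IH] //=; rewrite -IH; exact: h.
Qed.

Let bT_chain mid c d : bT (chain mid c) d = chain mid (bT c d).
Proof.
case: Tmx => _ [_ _ _ h].
by elim: mid => [|p mid IH] //=; rewrite -IH; exact: h.
Qed.

Definition lift_hom_at (t s : tree) : Prop :=
  [/\ DT_lift (precDT q << t >> << s >>) = pT (tree_lift t) (tree_lift s),
      DT_lift (succDT q << t >> << s >>) = sT (tree_lift t) (tree_lift s)
    & DT_lift (bulDT q << t >> << s >>) = bT (tree_lift t) (tree_lift s)].

Let lift_star t s : lift_hom_at t s ->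
  DT_lift (starDT q << t >> << s >>) = star_op q pT sT bT (tree_lift t) (tree_lift s).
Proof.
have LU r : DT_lift << r >> = tree_lift r by exact: linU.
move=> [h1 h2 h3]; rewrite starDTE -!LU; apply: star_op_hom_at.
- exact: linP.
- by rewrite !LU.
- by rewrite !LU.
- by rewrite !LU.
Qed.

(** The relation a < (b * c) = (a < b) < c turns the star inside the last child into an iterated
    product. *)
Let pE_ostar c o s : oP (lift_hom_at^~ s) o ->
  pE c (ostar q << o >> << Some s >>) = pT (pO c o) (tree_lift s).
Proof.
case: o => [t|] /= h; last by rewrite ostar1l /pE linU.
rewrite -(dliftU k t) -(dliftU k s) ostar_lift pE_dlift lift_star //.
by case: Tmx => -[e _ _] _; rewrite e.
Qed.

(** The mirror case, by (a * b) > c = a > (b > c). *)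
Let sE_ostar c t o : oP (lift_hom_at t) o ->
  sE (ostar q << Some t >> << o >>) c = sT (tree_lift t) (sO o c).
Proof.
case: o => [s|] /= h; last by rewrite ostar1r /sE linU.
rewrite -(dliftU k t) -(dliftU k s) ostar_lift sE_dlift lift_star //.
by case: Tmx => -[_ _ e] _; rewrite e.
Qed.

(** For nontrivial trees, (c < (t * s)) . d = ((c < t) < s) . d = (c < t) . (s > d): the star in the
    shared child splits into one factor on each side. *)
Let bT_ostar c d o o' : oP (fun t => oP (lift_hom_at t) o') o ->
  bT (pE c (ostar q << o >> << o' >>)) d = bT (pO c o) (sO o' d).
Proof.
case: Tmx => -[e _ _] [_ e' _ _].
case: o => [t|] /=; last by rewrite ostar1l /pE linU; case: o' => [s|] //= _; rewrite e'.
case: o' => [s|] /= h; last by rewrite ostar1r /pE linU.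
rewrite -(dliftU k t) -(dliftU k s) ostar_lift pE_dlift lift_star //.
by rewrite -e' e.
Qed.

(** Products of trees recurse into the last child of [t], the first child of [s], or both; hence the
    same nested induction as for associativity. *)
Lemma tree_lift_hom t s : lift_hom_at t s.
Proof.
elim/ntree_ind': t s => t0 mid x tm _ _ IHt.
elim/ntree_ind' => s0 mid' y sm IHs _ _.
split.
- rewrite precDTU lift_graft_last pE_ostar; last first.
    by case: tm IHt {IHs} => //= t; apply.
  by rewrite (tree_liftE t0) pT_sO pT_chain.
- by rewrite succDTU lift_graft_first sE_ostar // (tree_liftE s0).
- rewrite bulDTU lift_graft_mid bT_ostar; last first.
    by case: tm IHt {IHs} => //= t IHt; case: s0 => //= s; apply: IHt.
  by rewrite (tree_liftE t0) (tree_liftE s0) bT_sO bT_chain.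
Qed.

Lemma DT_lift_linear : is_linear DT_lift.
Proof. exact: linP. Qed.

Lemma DT_lift_corolla y : DT_lift << corolla y >> = f y.
Proof. exact: linU. Qed.

Lemma bilinear_hom_ext (oD : DT -> DT -> DT) (oT : T -> T -> T) (g : DT -> T) :
  is_bilinear oD -> is_bilinear oT -> is_linear g ->
  (forall t s, g (oD << t >> << s >>) = oT (g << t >>) (g << s >>)) ->
  forall u v, g (oD u v) = oT (g u) (g v).
Proof.
move=> [Dr Dl] [Tr Tl] gL e u v; move: u; apply: lin_ext => [a i j|a i j|t].
- by rewrite (Dl _ a) gL.
- by rewrite gL (Tl _ a).
move: v; apply: lin_ext => [a i j|a i j|s].
- by rewrite Dr gL.
- by rewrite gL Tr.
exact: e.
Qed.

Lemma DT_lift_hom :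
  [/\ forall u v, DT_lift (precDT q u v) = pT (DT_lift u) (DT_lift v),
      forall u v, DT_lift (succDT q u v) = sT (DT_lift u) (DT_lift v)
    & forall u v, DT_lift (bulDT q u v) = bT (DT_lift u) (DT_lift v)].
Proof.
have LU t : DT_lift << t >> = tree_lift t by exact: linU.
split.
- apply: bilinear_hom_ext (precDT_bilinear Y q) pTb DT_lift_linear _ => t s.
  by rewrite !LU; case: (tree_lift_hom t s).
- apply: bilinear_hom_ext (succDT_bilinear Y q) sTb DT_lift_linear _ => t s.
  by rewrite !LU; case: (tree_lift_hom t s).
- apply: bilinear_hom_ext (bulDT_bilinear Y q) bTb DT_lift_linear _ => t s.
  by rewrite !LU; case: (tree_lift_hom t s).
Qed.

End Lift.

(** * Extension of scalars by eps with eps^2 = lam eps *)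

(* V * V is the extension V[eps] of scalars, with eps^2 = lam eps: v + d eps is the
   pair (v, d). A map d is a derivation of weight lam iff v |-> v + d(v) eps is a
   homomorphism. *)
Section WeightExtension.
Variables (k : comNzRingType) (V : lmodType k) (lam : k).
Implicit Types (o : V -> V -> V) (a b c : V * V).

Definition ext_op o a b : V * V :=
  (o a.1 b.1, o a.2 b.1 + o a.1 b.2 + lam *: o a.2 b.2).

Let pair_linear r (v v' w w' : V) :
  r *: (v, v') + (w, w') = (r *: v + w, r *: v' + w').
Proof. by []. Qed.

Lemma ext_op_bilinear o : is_bilinear o -> is_bilinear (ext_op o).
Proof.
move=> [oR oL]; split=> -[u u'] r [v v'] [w w']; rewrite /ext_op !pair_linear /=.
  rewrite !oR; congr pair; rewrite [lam *: _]scalerDr !scalerDr !scalerA.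
  by rewrite (mulrC lam) !addrA [LHS](ACl (1*3*5*2*4*6)).
rewrite !(oL _ r); congr pair; rewrite [lam *: _]scalerDr !scalerDr !scalerA.
by rewrite (mulrC lam) !addrA [LHS](ACl (1*3*5*2*4*6)).
Qed.

(** The eps coefficient of either bracketing has seven terms, one for each nonempty set of factors
    replaced by their eps parts, weighted by lam to the size of the set minus one. They match term
    by term. *)
Lemma ext_op_mixed o1 o2 o3 o4 :
  is_bilinear o2 -> is_bilinear o3 -> mixed_assoc o1 o2 o3 o4 ->
  mixed_assoc (ext_op o1) (ext_op o2) (ext_op o3) (ext_op o4).
Proof.
move=> [_ l2] [r3 _] h [a a'] [b b'] [c c']; rewrite /ext_op /= h; congr pair.
rewrite !(is_linearD (l2 _)) !(is_linearZ (l2 _)) !h.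
rewrite !(is_linearD (r3 _)) !(is_linearZ (r3 _)) !scalerDr !addrA.
by rewrite [RHS](ACl (1*2*5*3*6*4*7)).
Qed.

Lemma ext_op_star q pr su bu a b :
  star_op q (ext_op pr) (ext_op su) (ext_op bu) a b =
  ext_op (star_op q pr su bu) a b.
Proof.
rewrite /star_op /ext_op; congr pair => /=.
by rewrite !scalerDr !scalerA (mulrC q) !addrA [LHS](ACl (1*4*7*2*5*8*3*6*9)).
Qed.

Lemma ext_op_qtridend q pr su bu :
  is_bilinear pr -> is_bilinear su -> is_bilinear bu ->
  qtridend_axioms q pr su bu ->
  qtridend_axioms q (ext_op pr) (ext_op su) (ext_op bu).
Proof.
move=> pb sb bb /qtridend_mixed [[h1 h2 h3] [h4 h5 h6 h7]].
apply/qtridend_mixed.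
have starE : star_op q (ext_op pr) (ext_op su) (ext_op bu) =
    ext_op (star_op q pr su bu).
  by do 2![apply: funext => ?]; exact: ext_op_star.
by rewrite /= starE; split; split; apply: ext_op_mixed.
Qed.

(** Multiplication by eps: (v + d eps) eps = (v + lam d) eps. *)
Definition ext_eps a : V * V := (0, a.1 + lam *: a.2).

Lemma ext_eps_linear : is_linear ext_eps.
Proof.
move=> r [u u'] [v v']; rewrite /ext_eps !pair_linear; congr pair => /=.
  by rewrite scaler0 addr0.
by rewrite !scalerDr !scalerA (mulrC lam) addrACA.
Qed.

Lemma ext_op_epsl o a b : is_bilinear o ->
  ext_op o (ext_eps a) b = ext_eps (ext_op o a b).
Proof.
move=> [_ oL]; rewrite /ext_op /ext_eps; congr pair => /=.
  exact: is_linear0 (oL _).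
rewrite (is_linear0 (oL _)) addr0 !(is_linearD (oL _)) !(is_linearZ (oL _)).
by rewrite !scalerDr !addrA.
Qed.

Lemma ext_op_epsr o a b : is_bilinear o ->
  ext_op o a (ext_eps b) = ext_eps (ext_op o a b).
Proof.
move=> [oR _]; rewrite /ext_op /ext_eps; congr pair => /=.
  exact: is_linear0 (oR _).
rewrite !(is_linear0 (oR _)) add0r !(is_linearD (oR _)) !(is_linearZ (oR _)).
by rewrite !scalerDr !addrA [LHS](ACl (1*3*2*4)).
Qed.

(* The sum of eps^n F(a) over the entries (n, a) of a list such as [vars t]. *)
Definition eps_sum (A : Type) (F : A -> V * V) (s : seq (nat * A)) : V * V :=
  \sum_(p <- s) iter p.1 ext_eps (F p.2).

Lemma iter_eps_linear n : is_linear (iter n ext_eps).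
Proof. by elim: n => [|n IH] r u v //=; rewrite IH ext_eps_linear. Qed.

Lemma eq_eps_sum (A : Type) (F G : A -> V * V) s :
  F =1 G -> eps_sum F s = eps_sum G s.
Proof. by move=> e; apply: eq_bigr => p _; rewrite e. Qed.

Lemma eps_sum1 (A : Type) (F : A -> V * V) (x : A) : eps_sum F [:: (0%N, x)] = F x.
Proof. exact: big_seq1. Qed.

Lemma eps_sum_map (A B : Type) (F : B -> V * V) (g : A -> B) s :
  eps_sum F [seq (p.1, g p.2) | p <- s] = eps_sum (F \o g) s.
Proof. exact: big_map. Qed.

(** [comb] adds the counts, and eps^(m+n) = eps^m eps^n, so independent choices give iterated
    sums. *)
Lemma eps_sum_comb (A B C : Type) (F : C -> V * V) (g : A -> B -> C) s t :
  eps_sum F (comb g s t) = eps_sum (fun x => eps_sum (fun y => F (g x y)) t) s.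
Proof.
rewrite /eps_sum /comb big_allpairs_dep; apply: eq_bigr => p _.
rewrite (is_linear_sum (iter_eps_linear _)); apply: eq_bigr => r _.
exact: iterD.
Qed.

Lemma ext_op_eps_suml (A : Type) o (F : A -> V * V) s b : is_bilinear o ->
  ext_op o (eps_sum F s) b = eps_sum (fun x => ext_op o (F x) b) s.
Proof.
move=> ob; rewrite (is_linear_sum ((ext_op_bilinear ob).2 b)).
apply: eq_bigr => -[n a] _ /=; elim: n => //= n <-; exact: ext_op_epsl.
Qed.

Lemma ext_op_eps_sumr (A : Type) o (F : A -> V * V) s a : is_bilinear o ->
  ext_op o a (eps_sum F s) = eps_sum (fun x => ext_op o a (F x)) s.
Proof.
move=> ob; rewrite (is_linear_sum ((ext_op_bilinear ob).1 a)).
apply: eq_bigr => -[n b] _ /=; elim: n => //= n <-; exact: ext_op_epsr.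
Qed.

Lemma ext_op0 o (u v : V) : is_bilinear o -> ext_op o (u, 0) (v, 0) = (o u v, 0).
Proof.
move=> [oR oL]; rewrite /ext_op /=; congr pair.
by rewrite !(is_linear0 (oR _)) (is_linear0 (oL _)) scaler0 !addr0.
Qed.

(** For n >= 1 one has eps^n = lam^(n-1) eps, whereas entries with n = 0 contribute nothing to the
    eps coefficient. *)
Lemma eps_sum_snd (A : Type) (F : A -> V) s :
  (eps_sum (fun x => (F x, 0)) s).2 =
  \sum_(p <- s | (0 < p.1)%N) lam ^+ p.1.-1 *: F p.2.
Proof.
rewrite /eps_sum (is_linear_sum (h := @snd V V)) //.
rewrite [RHS]big_mkcond; apply: eq_bigr => -[[|n] a] _ //=.
suff -> : iter n ext_eps (F a, 0) = if n is m.+1 then (0, lam ^+ m *: F a) else (F a, 0).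
  by case: n => [|n] /=; rewrite ?scaler0 ?addr0 ?expr0 ?scale1r // add0r scalerA -exprS.
elim: n => //= n ->; rewrite /ext_eps; case: n => [|n] /=.
  by rewrite scaler0 addr0 expr0 scale1r.
by rewrite add0r scalerA -exprS.
Qed.

End WeightExtension.

Lemma eps_sum_choices (k : comNzRingType) (lam : k) (X : Type) (V : lmodType k)
    (F : DeltaX X -> V) (y : DeltaX X) :
  eps_sum lam (fun y => (F y, 0)) (choices y) = (F y, F (Defs.bump y)).
Proof.
rewrite /eps_sum /choices big_cons big_seq1 /= /ext_eps /=.
by congr pair => /=; rewrite ?scaler0 ?addr0 ?add0r.
Qed.

(** * The derivation on decorated trees *)

Section Derivation.
Variables (k : comNzRingType) (X : Type) (lam q : k).
Local Notation Y := (DeltaX X).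
Local Notation tree := (ntree Y).
Local Notation otree := (option tree).
Local Notation DT := {malg k[tree]}.
Local Notation pr := (@precDT k Y q).
Local Notation su := (@succDT k Y q).
Local Notation bu := (@bulDT k Y q).
Local Notation ext := (ext_op lam).
Local Notation eps_sum := (eps_sum lam).
Local Notation bump := (@Defs.bump X).

Let pb : is_bilinear pr := precDT_bilinear Y q.
Let sb : is_bilinear su := succDT_bilinear Y q.
Let bb : is_bilinear bu := bulDT_bilinear Y q.

(** A named copy of the fixpoint local to [vars], convertible to it. *)
Fixpoint mid_vars (l : seq (Y * otree)) : seq (nat * seq (Y * otree)) :=
  match l with
  | [::] => [:: (0%N, [::])]
  | (y, o) :: l' =>
      comb (fun y' rest => (y', rest.1) :: rest.2)
        (choices y) (comb pair (ovars_with (@vars X) o) (mid_vars l'))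
  end.

Lemma varsE t0 mid (ym : Y) tm : vars (NNode t0 mid ym tm) =
  comb (fun u0 rest => NNode u0 rest.1 rest.2.1 rest.2.2)
    (ovars_with (@vars X) t0)
    (comb pair (mid_vars mid) (comb pair (choices ym) (ovars_with (@vars X) tm))).
Proof. by []. Qed.

Definition basis_ext (t : tree) : DT * DT := (<< t >>, 0).

Lemma basis_ext_op (o : DT -> DT -> DT) t s r : is_bilinear o ->
  << r >> = o << t >> << s >> -> basis_ext r = ext o (basis_ext t) (basis_ext s).
Proof. by move=> ob e; rewrite /basis_ext ext_op0 // e. Qed.

(** The sum of eps^|S| t_S over all subsets S, the empty one included. *)
Definition var_ext (t : tree) : DT * DT := eps_sum basis_ext (vars t).

Lemma var_extE t0 mid (ym : Y) tm : var_ext (NNode t0 mid ym tm) =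
  eps_sum (fun o0 => eps_sum (fun mid' => eps_sum (fun y => eps_sum (fun o =>
    basis_ext (NNode o0 mid' y o)) (ovars_with (@vars X) tm)) (choices ym))
    (mid_vars mid)) (ovars_with (@vars X) t0).
Proof.
rewrite /var_ext varsE eps_sum_comb; apply: eq_eps_sum => o0.
rewrite eps_sum_comb; apply: eq_eps_sum => mid'.
exact: eps_sum_comb.
Qed.

Lemma var_extE_None mid (ym : Y) tm : var_ext (NNode None mid ym tm) =
  eps_sum (fun mid' => eps_sum (fun y => eps_sum (fun o =>
    basis_ext (NNode None mid' y o)) (ovars_with (@vars X) tm)) (choices ym))
    (mid_vars mid).
Proof. rewrite var_extE; exact: eps_sum1. Qed.

Lemma var_extE_node (x : Y) o : var_ext (NNode None [::] x o) =
  eps_sum (fun y => eps_sum (fun o' => basis_ext (NNode None [::] y o'))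
    (ovars_with (@vars X) o)) (choices x).
Proof. rewrite var_extE_None; exact: eps_sum1. Qed.

Lemma var_extE_corolla (x : Y) :
  var_ext (corolla x) = eps_sum (fun y => basis_ext (corolla y)) (choices x).
Proof. rewrite var_extE_node; apply: eq_eps_sum => y; exact: eps_sum1. Qed.

Lemma var_ext_corolla (y : Y) :
  var_ext (corolla y) = (<< corolla y >>, << corolla (bump y) >>).
Proof.
rewrite var_extE_corolla.
exact: (eps_sum_choices lam (fun y : Y => << corolla y >> : DT)).
Qed.

(** A subset of the entries of a product is a pair of subsets, one for each factor, so the sum over
    subsets factors. The same reason applies to the two other operations below. *)
Lemma var_ext_prec (x : Y) t :
  var_ext (NNode None [::] x (Some t)) = ext pr (var_ext (corolla x)) (var_ext t).
Proof.
rewrite var_extE_node var_extE_corolla (ext_op_eps_suml _ _ _ _ pb).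
apply: eq_eps_sum => y.
rewrite eps_sum_map /var_ext (ext_op_eps_sumr _ _ _ _ pb); apply: eq_eps_sum => s.
exact: basis_ext_op pb (NNode_prec q y s).
Qed.

Lemma var_ext_bul (x : Y) o mid (ym : Y) tm :
  var_ext (NNode None ((x, o) :: mid) ym tm) =
  ext bu (var_ext (NNode None [::] x o)) (var_ext (NNode None mid ym tm)).
Proof.
rewrite var_extE_node !var_extE_None.
rewrite eps_sum_comb (ext_op_eps_suml _ _ _ _ bb); apply: eq_eps_sum => x'.
rewrite eps_sum_comb (ext_op_eps_suml _ _ _ _ bb); apply: eq_eps_sum => o'.
rewrite (ext_op_eps_sumr _ _ _ _ bb); apply: eq_eps_sum => mid'.
rewrite (ext_op_eps_sumr _ _ _ _ bb); apply: eq_eps_sum => y.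
rewrite (ext_op_eps_sumr _ _ _ _ bb); apply: eq_eps_sum => tm'.
exact: basis_ext_op bb (NNode_bul q x' o' mid' y tm').
Qed.

Lemma var_ext_succ b mid (ym : Y) tm :
  var_ext (NNode (Some b) mid ym tm) =
  ext su (var_ext b) (var_ext (NNode None mid ym tm)).
Proof.
rewrite var_extE var_extE_None eps_sum_map /var_ext (ext_op_eps_suml _ _ _ _ sb).
apply: eq_eps_sum => b'.
rewrite (ext_op_eps_sumr _ _ _ _ sb); apply: eq_eps_sum => mid'.
rewrite (ext_op_eps_sumr _ _ _ _ sb); apply: eq_eps_sum => y.
rewrite (ext_op_eps_sumr _ _ _ _ sb); apply: eq_eps_sum => tm'.
exact: basis_ext_op sb (NNode_succ q b' mid' y tm').
Qed.

Definition ext_lift : DT -> DT * DT :=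
  DT_lift (ext pr) (ext su) (ext bu)
    (fun y : Y => (<< corolla y >>, << corolla (bump y) >>)).

Let ext_hom := DT_lift_hom (fun y : Y => (<< corolla y >>, << corolla (bump y) >>))
  (ext_op_bilinear lam pb) (ext_op_bilinear lam sb) (ext_op_bilinear lam bb)
  (ext_op_qtridend lam pb sb bb (@qtridend_DT k Y q)).

Lemma ext_lift_prec u v : ext_lift (pr u v) = ext pr (ext_lift u) (ext_lift v).
Proof. by case: ext_hom => h _ _; exact: h. Qed.

Lemma ext_lift_succ u v : ext_lift (su u v) = ext su (ext_lift u) (ext_lift v).
Proof. by case: ext_hom => _ h _; exact: h. Qed.

Lemma ext_lift_bul u v : ext_lift (bu u v) = ext bu (ext_lift u) (ext_lift v).
Proof. by case: ext_hom => _ _ h; exact: h. Qed.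

Lemma ext_lift_corolla (y : Y) :
  ext_lift << corolla y >> = (<< corolla y >>, << corolla (bump y) >>).
Proof. exact: DT_lift_corolla. Qed.

Lemma ext_lift_linear : is_linear ext_lift.
Proof. exact: DT_lift_linear. Qed.

Lemma ext_lift_var t : ext_lift << t >> = var_ext t.
Proof.
elim/ntree_ind_generated: t => [y|x t IH|x o mid y tm IHo IH|b mid y tm IHb IH].
- by rewrite ext_lift_corolla var_ext_corolla.
- by rewrite (NNode_prec q) ext_lift_prec ext_lift_corolla IH var_ext_prec var_ext_corolla.
- by rewrite (NNode_bul q) ext_lift_bul IHo IH var_ext_bul.
- by rewrite (NNode_succ q) ext_lift_succ IHb IH var_ext_succ.
Qed.

(** Taking the first component is a homomorphism, and the composite fixes the one-vertex trees,
    hence is the identity. *)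
Lemma ext_lift_fst u : (ext_lift u).1 = u.
Proof.
move: u; apply: lin_ext => [a u v|a u v|].
- by rewrite ext_lift_linear.
- exact: erefl.
apply: (DT_generated (q := q) (P := fun u => (ext_lift u).1 = u)) => [y|u v IHu IHv|u v IHu IHv|u v IHu IHv].
- by rewrite ext_lift_corolla.
- by rewrite ext_lift_prec /= IHu IHv.
- by rewrite ext_lift_succ /= IHu IHv.
- by rewrite ext_lift_bul /= IHu IHv.
Qed.

Lemma dXE (u : DT) : dX X lam u = lin (dX_tree lam) u.
Proof. by rewrite lin.unlock. Qed.

Lemma dX_linear : is_linear (dX X lam : DT -> DT).
Proof. by move=> a u v; rewrite !dXE linP. Qed.

Lemma ext_lift_snd u : (ext_lift u).2 = dX X lam u.
Proof.
move: u; apply: lin_ext => [a u v||t].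
- by rewrite ext_lift_linear.
- exact: dX_linear.
rewrite ext_lift_var dXE linU /var_ext /basis_ext.
exact: (eps_sum_snd lam (fun t : tree => << t >> : DT)).
Qed.

Lemma dX_corolla (y : Y) : dX X lam (<< corolla y >> : DT) = << corolla (bump y) >>.
Proof. by rewrite -ext_lift_snd ext_lift_corolla. Qed.

(** The eps component of the homomorphism law, with [ext_lift u] equal to u + d_X(u) eps, is the
    derivation law. *)
Lemma dX_derivation_of o :
  (forall u v, ext_lift (o u v) = ext o (ext_lift u) (ext_lift v)) ->
  is_derivation lam (dX X lam : DT -> DT) o.
Proof.
by move=> h u v; rewrite -!ext_lift_snd h /ext_op !ext_lift_fst.
Qed.

Lemma diff_qtridend_DT : diff_qtridend q lam pr su bu (dX X lam).
Proof.
split; [exact: pb | exact: sb | exact: bb | exact: qtridend_DT | split].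
  exact: dX_linear.
split; apply: dX_derivation_of.
- exact: ext_lift_prec.
- exact: ext_lift_succ.
- exact: ext_lift_bul.
Qed.

End Derivation.

(** * Existence and uniqueness of the lift *)

Section Freeness.
Variables (k : comNzRingType) (X : Type) (lam q : k).
Local Notation Y := (DeltaX X).
Local Notation DT := {malg k[ntree Y]}.
Variables (T : lmodType k) (pT sT bT : T -> T -> T) (dT : T -> T) (f : X -> T).
Hypothesis TD : diff_qtridend q lam pT sT bT dT.

Lemma free_lift_exists : exists fb : DT -> T, is_free_lift lam q pT sT bT dT f fb.
Proof.
case: TD => pTb sTb bTb Tax [dL [dp ds db]].
case: (diff_qtridend_DT X lam q) => pb sb bb _ [DL [Dp Ds Db]].
(* As d_X sends the corolla of x^(n) to that of x^(n+1), commuting with the derivations forces the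
   value d_T^n(f(x)) on x^(n). *)
pose g (y : Y) := iter y.2 dT (f y.1).
case: (DT_lift_hom g pTb sTb bTb Tax) => hp hs hb.
exists (DT_lift pT sT bT g); split; first exact: DT_lift_linear.
have gL := DT_lift_linear (Y := Y) pT sT bT g.
(* Commutation with the derivations passes from two elements to their product, so it need only be
   checked on corollas. *)
have comm o oT : is_derivation lam (dX X lam : DT -> DT) o -> is_derivation lam dT oT ->
    (forall u v, DT_lift pT sT bT g (o u v) =
       oT (DT_lift pT sT bT g u) (DT_lift pT sT bT g v)) ->
    forall u v, dT (DT_lift pT sT bT g u) = DT_lift pT sT bT g (dX X lam u) ->
      dT (DT_lift pT sT bT g v) = DT_lift pT sT bT g (dX X lam v) ->
      dT (DT_lift pT sT bT g (o u v)) = DT_lift pT sT bT g (dX X lam (o u v)).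
  move=> od oTd h u v IHu IHv; rewrite h oTd od !(is_linearD gL) (is_linearZ gL) !h.
  by rewrite IHu IHv.
split=> [||||x]; [exact: hp | exact: hs | exact: hb | | exact: (DT_lift_corolla pT sT bT g)].
apply: lin_ext => [a u v|a u v|].
- by rewrite gL dL.
- by rewrite DL gL.
apply: (DT_generated (q := q) (P := fun u =>
  dT (DT_lift pT sT bT g u) = DT_lift pT sT bT g (dX X lam u))).
- move=> y.
  have e := congr1 (DT_lift pT sT bT g) (dX_corolla lam q y).
  apply: etrans _ (esym e).
  have ey := DT_lift_corolla pT sT bT g y.
  have eb := DT_lift_corolla pT sT bT g (Defs.bump y).
  exact: etrans (congr1 dT ey) (esym eb).
- exact: comm Dp dp hp.
- exact: comm Ds ds hs.
- exact: comm Db db hb.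
Qed.

Lemma free_lift_unique (g1 g2 : DT -> T) :
  is_free_lift lam q pT sT bT dT f g1 -> is_free_lift lam q pT sT bT dT f g2 ->
  forall u, g1 u = g2 u.
Proof.
move=> [L1 [p1 s1 b1 d1 j1]] [L2 [p2 s2 b2 d2 j2]]; apply: lin_ext => //.
apply: (DT_generated (q := q) (P := fun u => g1 u = g2 u)) => [[x n]|u v IHu IHv|u v IHu IHv|u v IHu IHv].
(* The corolla of x^(n) is the n-th d_X-derivative of j_X(x), where both maps are prescribed. *)
- elim: n => [|n IH]; first exact: etrans (j1 x) (esym (j2 x)).
  have -> : << corolla ((x, n.+1) : Y) >> = dX X lam (<< corolla ((x, n) : Y) >> : DT).
    by rewrite dX_corolla.
  by rewrite -d1 -d2 IH.
- by rewrite p1 p2 IHu IHv.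
- by rewrite s1 s2 IHu IHv.
- by rewrite b1 b2 IHu IHv.
Qed.

End Freeness.

Theorem theorem5p4 (k : comNzRingType) (X : Type) (lam q : k) :
  diff_qtridend q lam (precDT q) (succDT q) (bulDT q) (dX X lam)
  /\
  (forall (T : lmodType k) (pT sT bT : T -> T -> T) (dT : T -> T),
     diff_qtridend q lam pT sT bT dT ->
     forall f : X -> T,
       (exists fb : {malg k[ntree (DeltaX X)]} -> T,
          is_free_lift lam q pT sT bT dT f fb)
       /\
       (forall g1 g2 : {malg k[ntree (DeltaX X)]} -> T,
          is_free_lift lam q pT sT bT dT f g1 ->
          is_free_lift lam q pT sT bT dT f g2 ->
          forall u, g1 u = g2 u)).
Proof.
split; first exact: diff_qtridend_DT.
move=> T pT sT bT dT TD f; split; first exact: free_lift_exists TD.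
exact: free_lift_unique.
Qed.
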